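(* Let $\mathbb{F}$ be a field and $d \geq 2$. Let $P$ be a set of $n$ points in $\mathbb{F}^d$ such that no $s$ points of $P$ are contained in any single hyperplane, and no $t$ points of $P$ are contained in any single $(d-2)$-plane. Let $\alpha,\beta \in \mathbb{F} \setminus \{0\}$. Then \[|\Pi_{\alpha,\beta}(P)| \leq \min\big(2s^2n,\ O(tn^2)\big),\] where the implied constant is absolute.
   Context: For a field $\mathbb{F}$, a finite set $P \subseteq \mathbb{F}^d$ and $\alpha,\beta \in \mathbb{F}$, define $\Pi_{\alpha,\beta}(P) = \{(p,q,r) \in P \times P \times P \mid p \cdot q = \alpha,\ p \cdot r = \beta\}$, where $\cdot$ is the standard dot product. A $k$-plane is a $k$-dimensional affine subspace of $\mathbb{F}^d$; a hyperplane is a $(d-1)$-plane. ''No $s$ points are contained in any hyperplane'' means every hyperplane contains fewer than $s$ points of $P$, and similarly for $(d-2)$-planes and $t$. *)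

(* Defs.v *)
From mathcomp Require Import all_boot all_algebra.
From mathcomp Require Import finmap.

Set Implicit Arguments.
Unset Strict Implicit.
Unset Printing Implicit Defensive.

Import GRing.Theory.
Local Open Scope ring_scope.
Local Open Scope fset_scope.

Definition dot (F : fieldType) (d : nat) (u v : 'rV[F]_d) : F :=
  \sum_(i < d) u 0 i * v 0 i.

Definition Pi (F : fieldType) (d : nat) (alpha beta : F)
    (P : {fset 'rV[F]_d}) : {fset 'rV[F]_d * 'rV[F]_d * 'rV[F]_d} :=
  [fset x in P `*` P `*` P |
    (dot x.1.1 x.1.2 == alpha) && (dot x.1.1 x.2 == beta)].

Definition is_plane (F : fieldType) (d k : nat) (A : {pred 'rV[F]_d}) : Prop :=
  exists (v : 'rV[F]_d) (U : {vspace 'rV[F]_d}),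
    \dim U = k /\ forall x : 'rV[F]_d, (x \in A) = (x - v \in U).

(* The subtraction is truncated, so this is the intended notion only for d > 0. *)
Definition is_hyperplane (F : fieldType) (d : nat) (A : {pred 'rV[F]_d}) : Prop :=
  is_plane (d - 1) A.

Definition points_in (F : fieldType) (d : nat) (P : {fset 'rV[F]_d})
    (A : {pred 'rV[F]_d}) : {fset 'rV[F]_d} :=
  [fset x in P | x \in A].

(* Main.v *)
(* Once p is fixed, q and r range over two hyperplanes, which gives n s^2.
   Once (q, r) is fixed, p ranges over a (d-2)-plane if q and r are linearly
   independent, which gives t n^2; otherwise r = (beta / alpha) q is determined
   by q, which leaves n^2 further triples, and t > 0. *)
Require Import Defs.
From mathcomp Require Import all_boot all_algebra.
From mathcomp Require Import finmap.

Set Implicit Arguments.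
Unset Strict Implicit.

Import GRing.Theory.
Local Open Scope ring_scope.
Local Open Scope fset_scope.

(** The double-counting tool behind every count of triples below. With [k = 1] it acts as an
    injectivity bound. *)
Lemma card_fset_fibers (T U : choiceType) (f : T -> U) (S : {fset T})
    (B : {fset U}) (k : nat) :
  (forall x, x \in S -> f x \in B) ->
  (forall b, b \in B -> (#|` [fset x in S | f x == b]| <= k)%N) ->
  (#|` S| <= #|` B| * k)%N.
Proof.
move=> SB fibk.
have fSB : [fset f x | x in S] `<=` B.
  by apply/fsubsetP => _ /imfsetP[x /= xS ->]; apply: SB.
apply: (@leq_trans (#|` [fset f x | x in S]| * k)); last first.
  by rewrite leq_mul2r fsubset_leq_card ?orbT.
rewrite -sum1_size (partition_big_imfset _ f) /= mulnC -[#|` [fset f x | x in S]|]sum1_size big_distrr /=.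
rewrite big_seq [leqRHS]big_seq; apply: leq_sum => b bS.
have := fibk b (fsubsetP fSB _ bS); rewrite -sum1_size big_fset /=.
by rewrite muln1.
Qed.

Lemma cardfsM (T U : choiceType) (A : {fset T}) (B : {fset U}) :
  #|` A `*` B| = (#|` A| * #|` B|)%N.
Proof.
rewrite -(size_allpairs pair); apply/perm_size/uniq_perm.
- exact: fset_uniq.
- by apply: allpairs_uniq => // -[? ?] [? ?].
move=> [a b]; rewrite in_fsetM; apply/andP/allpairsP => /=.
  by move=> [aA bB]; exists (a, b).
by move=> [[a' b'] /= [aA bB [-> ->]]].
Qed.

Section Planes.
Variables (F : fieldType) (d : nat).
Implicit Types p q r x : 'rV[F]_d.

Lemma dotC p q : dot p q = dot q p.
Proof. by apply: eq_bigr => i _; rewrite mulrC. Qed.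

Lemma dotE p q : dot p q = (p *m q^T) 0 0.
Proof. by rewrite mxE; apply: eq_bigr => i _; rewrite mxE. Qed.

Lemma dotZr (a : F) p q : dot p (a *: q) = a * dot p q.
Proof. by rewrite !dotE linearZ -scalemxAr mxE. Qed.

Lemma dot_neq0 p q : dot p q != 0 -> q != 0.
Proof. by apply: contraNneq => ->; rewrite dotE trmx0 mulmx0 mxE. Qed.

(** Full rank makes [x *m M] surjective in [x]. So a particular solution [v] exists, and
    rank-nullity gives the kernel, which is the direction space, dimension [d - k]. *)
Lemma solution_set_plane (k : nat) (M : 'M[F]_(d, k)) (b : 'rV[F]_k) :
  row_full M -> is_plane (d - k) [pred x : 'rV[F]_d | x *m M == b].
Proof.
move=> fullM; have /submxP[v vM] : (b <= M)%MS by apply: submx_full.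
pose g : 'Hom('rV[F]_d, 'rV[F]_k) := linfun (mulmxr M).
exists v, (lker g); split.
  have g_full : limg g = fullv.
    apply/eqP; rewrite eqEsubv subvf; apply/subvP => y _.
    have /submxP[x ->] : (y <= M)%MS by apply: submx_full.
    by have := memv_img g (memvf x); rewrite lfunE.
  have := limg_ker_dim g fullv; rewrite capfv g_full !dimvf /dim /= !mul1n.
  by move/(congr1 (subn^~ k)); rewrite addnK.
move=> x; rewrite memv_ker lfunE /= mulmxBl -vM subr_eq0.
by [].
Qed.

Lemma dot_hyperplane (a : F) p :
  p != 0 -> is_hyperplane [pred x : 'rV[F]_d | dot p x == a].
Proof.
move=> p0; have fullp : row_full p^T by rewrite /row_full mxrank_tr rank_rV p0.
have [v [U [dimU UE]]] := solution_set_plane (a%:M) fullp.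
exists v, U; split=> // x; rewrite -UE !inE dotC dotE.
apply/eqP/eqP => [<-|->]; last by rewrite mxE eqxx.
exact: mx11_scalar.
Qed.

Lemma dot_codim2_plane (a b : F) q r :
  q != 0 -> ~~ (r <= q)%MS ->
  is_plane (d - 2) [pred x : 'rV[F]_d | (dot x q == a) && (dot x r == b)].
Proof.
move=> q0 rq.
have full_qr : row_full (col_mx q r)^T.
  rewrite /row_full mxrank_tr eqn_leq rank_leq_row /=.
  (* As [r] is not a multiple of [q], stacking it strictly enlarges the row space, so the rank
     exceeds that of [q], which is 1. *)
  have : (q < col_mx q r)%MS.
    by rewrite /ltmx -!addsmxE addsmxSl addsmx_sub submx_refl.
  by move/rank_ltmx; rewrite rank_rV q0.
have [v [U [dimU UE]]] := solution_set_plane (row_mx a%:M b%:M) full_qr.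
exists v, U; split=> // x; rewrite -UE !inE tr_col_mx mul_mx_row !dotE.
apply/andP/eqP => [[/eqP <- /eqP <-]|/eq_row_mx[-> ->]].
  by rewrite -!mx11_scalar.
by rewrite !mxE !eqxx.
Qed.

End Planes.

Section Counting.
Variables (F : fieldType) (d : nat) (P : {fset 'rV[F]_d}) (alpha beta : F).
Hypothesis alpha0 : alpha != 0.

Lemma in_Pi p q r :
  ((p, q, r) \in Pi alpha beta P) =
  [&& p \in P, q \in P, r \in P, dot p q == alpha & dot p r == beta].
Proof. by rewrite !inE /= -!andbA. Qed.

Lemma card_Pi_hyperplane (s : nat) :
  (forall A : {pred 'rV[F]_d},
     is_hyperplane A -> (#|` points_in P A| < s)%N) ->
  (#|` Pi alpha beta P| <= #|` P| * s ^ 2)%N.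
Proof.
move=> hypP; apply: (card_fset_fibers (f := fun x => x.1.1)).
  by move=> [[p q] r]; rewrite in_Pi => /andP[].
(* For [p = 0] the equation [dot p q == alpha] is not a hyperplane, but it has no solution since
   [alpha] is nonzero. *)
move=> p pP; have [->|p0] := eqVneq p 0.
  rewrite (_ : [fset _ in _ | _] = fset0) ?cardfs0 //.
  apply/fsetP => -[[p' q] r]; rewrite !in_fset /= !inE /=.
  apply/negP => /andP[/andP[_ /andP[pq _]] /eqP p'0]; move: pq.
  by rewrite p'0 dotC dotE trmx0 mulmx0 mxE eq_sym (negbTE alpha0).
pose H a := points_in P [pred x | dot p x == a].
have Hs a : (#|` H a| <= s)%N by apply/ltnW/hypP/dot_hyperplane.
apply: (@leq_trans #|` [fset p] `*` H alpha `*` H beta|).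
  apply: fsubset_leq_card; apply/fsubsetP => -[[p' q] r].
  rewrite !inE /= => /andP[/andP[/andP[/andP[_ ->] ->] /andP[]]].
  by move=> pq pr /eqP p'E; rewrite -p'E pq pr eqxx.
by rewrite !cardfsM cardfs1 mul1n leq_mul.
Qed.

Lemma card_Pi_codim2 (t : nat) :
  (2 <= d)%N ->
  (forall A : {pred 'rV[F]_d},
     is_plane (d - 2) A -> (#|` points_in P A| < t)%N) ->
  (#|` Pi alpha beta P| <= 2 * (t * #|` P| ^ 2))%N.
Proof.
move=> d2 planeP.
(* Some (d-2)-plane exists, here the vanishing of the first two coordinates, and its number of
   points lies strictly below [t]. *)
have t0 : (0 < t)%N.
  have full : row_full (pid_mx 2 : 'M[F]_(d, 2)) by rewrite /row_full rank_pid_mx.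
  by apply: leq_trans (planeP _ (solution_set_plane 0 full)).
(* The only possible ratio: if [r = a *: q], then pairing with [p] gives [beta = a * alpha]. Hence
   [D] collects exactly the triples with [q] and [r] dependent. *)
pose c := beta / alpha.
pose D := [fset x in Pi alpha beta P | x.2 == c *: x.1.2].
have cardD : (#|` D| <= #|` P| ^ 2)%N.
  rewrite -mulnn -cardfsM -[leqRHS]muln1.
  apply: (card_fset_fibers (f := fst)).
    by move=> [[p q] r]; rewrite !inE /= => /andP[/andP[/andP[]]].
  move=> [p q] _; rewrite -[leqRHS](cardfs1 (p, q, c *: q)).
  apply/fsubset_leq_card/fsubsetP => -[[p' q'] r].
  by rewrite !inE /= => /andP[/andP[_ /eqP->] /eqP[-> ->]].
have cardPiD : (#|` Pi alpha beta P `\` D| <= t * #|` P| ^ 2)%N.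
  rewrite mulnC -mulnn -cardfsM.
  apply: (card_fset_fibers (f := fun x => (x.1.2, x.2))).
    by move=> [[p q] r]; rewrite in_fsetD in_Pi !inE /= => /and4P[_ _ -> /andP[->]].
  move=> [q r] _; set S := [fset _ in _ | _].
  have [->|[x0 x0S]] := fset_0Vmem S; first by rewrite cardfs0.
  have inS p q' r' : (p, q', r') \in S ->
      [/\ p \in P, dot p q = alpha, dot p r = beta, r != c *: q & (q', r') = (q, r)].
    rewrite in_fset /= inE /= in_fsetD => /andP[/andP[nD xPi] /eqP qrE].
    move: nD; rewrite in_fset /= inE /= xPi /=; move: xPi qrE.
    by rewrite in_Pi => /and5P[pP _ _ /eqP pq /eqP pr] [<- <-].
  (* A single triple of the fibre certifies that [q] and [r] are independent, so the plane bound
     applies to the whole fibre. *)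
  case: x0 x0S => [[p q'] r'] /inS[_ pq pr rcq _].
  have q0 : q != 0 by apply: (@dot_neq0 _ _ p); rewrite pq.
  have rq : ~~ (r <= q)%MS.
    apply: contra rcq => /sub_rVP[a rE].
    by rewrite rE /c -pr rE dotZr pq mulfK.
  apply: leq_trans (ltnW (planeP _ (dot_codim2_plane alpha beta q0 rq))).
  set A := points_in _ _.
  rewrite -[leqRHS]muln1.
  (* With [q] and [r] fixed, a triple is determined by its first point, which lies in [A]. *)
  apply: (card_fset_fibers (f := fun x => x.1.1)).
    by move=> [[p1 q1] r1] /inS[p1P pq1 pr1 _ _]; rewrite !inE /= p1P pq1 pr1 !eqxx.
  move=> p1 _; rewrite -[leqRHS](cardfs1 (p1, q, r)).
  apply/fsubset_leq_card/fsubsetP => -[[p2 q2] r2].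
  by rewrite in_fset /= inE /= => /andP[/inS[_ _ _ _ [-> ->]] /eqP->]; rewrite inE.
(* Each of the two parts costs at most [t * n ^ 2], where [n] is the size of [P]; for [D] this uses
   [t0]. *)
rewrite -(cardfsID D) mul2n -addnn leq_add //.
apply: leq_trans (fsubset_leq_card (fsubsetIr _ _)) _.
by apply: leq_trans cardD _; rewrite leq_pmull.
Qed.

End Counting.

Theorem theorem1p5 :
  exists C : nat,
    forall (F : fieldType) (d : nat) (P : {fset 'rV[F]_d}) (n s t : nat)
           (alpha beta : F),
      (2 <= d)%N ->
      #|` P| = n ->
      (forall A : {pred 'rV[F]_d},
          is_hyperplane A -> (#|` points_in P A| < s)%N) ->
      (forall A : {pred 'rV[F]_d},
          is_plane (d - 2) A -> (#|` points_in P A| < t)%N) ->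
      alpha != 0 ->
      beta != 0 ->
      (#|` Pi alpha beta P| <= minn (2 * s ^ 2 * n) (C * (t * n ^ 2)))%N.
Proof.
(* The constant 2 counts the dependent and the independent triples, one [t * n ^ 2] for each. *)
exists 2 => F d P n s t alpha beta d2 <- hypP planeP alpha0 _.
rewrite leq_min card_Pi_codim2 // andbT.
apply: leq_trans (card_Pi_hyperplane _ alpha0 hypP) _.
by rewrite mulnC -mulnA leq_pmull.
Qed.
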